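(* Let $s,n$ be positive integers and $K$ a real number with $2\leq K\leq \frac{s}{2^{120}(\log n)^3}$, and let $J\subset [n]=\{1,\dots,n\}$ be chosen uniformly at random among all sets with $|J|=s$ and $|J+J|\leq K|J|$. Then with probability at least $1-\exp(-K^{1/6}s^{5/6}\sqrt{\log n})$ there is a set $T\subset J$ with $|T|\leq 2^{15} K^{1/6}s^{5/6}\sqrt{\log n}$ such that $J\setminus T$ is contained in an arithmetic progression (of integers) of size at most \[\frac{Ks}{2}+2^{17}K^{7/6}s^{5/6}\sqrt{\log n}.\]
   Context: $J+J=\{a+b: a,b\in J\}$; $\log$ is the natural logarithm. *)

(* Defs.v *)
From Stdlib Require Import Reals ZArith.
From mathcomp Require Import all_boot.
Set Implicit Arguments. Unset Strict Implicit. Unset Printing Implicit Defensive.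

(* [n] = {1,...,n} is represented inside 'I_n.+1 as the elements with value >= 1. *)
Definition in_range (n : nat) (J : {set 'I_n.+1}) : bool :=
  J \subset [set i : 'I_n.+1 | (0 < val i)%N].

Definition sumset_card (n : nat) (J : {set 'I_n.+1}) : nat :=
  size (undup [seq (val x + val y)%N | x <- enum J, y <- enum J]).

Definition Rleb (x y : R) : bool := if Rle_dec x y then true else false.

Definition admissible (n s : nat) (K : R) (J : {set 'I_n.+1}) : bool :=
  [&& in_range J, #|J| == s & Rleb (INR (sumset_card J)) (K * INR #|J|)].

Definition in_AP_of_size_le (n : nat) (S : {set 'I_n.+1}) (L : R) : Prop :=
  exists (a d : Z) (m : nat), Rle (INR m) L /\
    forall x, x \in S -> exists k : nat, (k < m)%N /\
      Z.of_nat (val x) = (a + d * Z.of_nat k)%Z.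

(* Main.v *)
(* Write [eps = (K/s)^(1/6) sqrt(log n)], [m = floor(K s)] and [J + J] for the sumset.

   Containers.  For a state [(A, B)] with [J] contained in [A] and [B] in [J + J], suppose that more
   than a proportion [1/D] of the pairs of [A x A] have their sum outside [B].  Query the
   elements of [A] one by one: an element outside [J] leaves [A], at no cost; up to [p] elements
   found in [J] are collected in a set [S], each having many sums with [A] outside [B]; then many
   elements [b] of [A] have many sums in [b + S] outside [B], and each such [b] found in [J]
   enlarges [B].  As [B] has at most [m] elements, about [D sqrt(m log n)] positive answers
   suffice, so that [exp(eps s)] containers [A] cover all sets [J], each of them having few pairs
   with sum outside [B] or at most [(1 - 4 eps) m / 2] elements.

   Structure.  If almost all sums of pairs of [A] lie in a set of [m] elements and [#|A|] is about
   [m / 2], remove the few elements with many bad sums and reduce modulo [N = max A - min A].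
   Then [A - A] is a subgroup of Z/N of size about [#|A|], hence [A] is close to a progression.

   Counting.  The sets [J] contained in a small container, or meeting the removed part of a large
   one in more than [2^15 eps s] elements, number at most [exp(- 2 eps s) C(l, s)] per container,
   where [l] is about [m / 2], while all [s]-subsets of [1..l] are admissible. *)
Require Import Defs.
From Stdlib Require Import Reals ZArith Lra.
From mathcomp Require Import all_boot fingroup zmodp cyclic.
From mathcomp Require Import zify.
Set Implicit Arguments. Unset Strict Implicit. Unset Printing Implicit Defensive.

(** * Containers for sets with small sumset *)

Section Containers.
Variables (T V : finType) (add : T -> T -> V).
Hypothesis addC : commutative add.
Hypothesis addI : right_injective add.
Variables (m p g D M0 : nat).

Definition defect (A : {set T}) (B : {set V}) (x : T) : nat :=
  #|[set y in A | add x y \notin B]|.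

Definition good_container (A : {set T}) : Prop :=
  exists B : {set V}, #|B| <= m /\
    (#|A| <= M0 \/ D * (\sum_(x in A) defect A B x) <= #|A| ^ 2).

Definition compatible (A : {set T}) (B : {set V}) (S J : {set T}) : Prop :=
  [/\ S \subset J, J \subset A, B \subset add @2: (J, J) & #|add @2: (J, J)| <= m].

(** [q] is the budget of positive answers: a run of the queries is determined by the places of its
    positive answers, whence a count of this form. *)
Definition coverable (A : {set T}) (B : {set V}) (S : {set T}) (q : nat) : Prop :=
  exists C : seq {set T},
    [/\ size C <= #|A|.+1 ^ q, {in C, forall X, good_container X} &
        forall J, compatible A B S J -> exists2 X, X \in C & J \subset X].

Implicit Types (A S J : {set T}) (B : {set V}).

Lemma coverable_stop A B S q :
  #|B| <= m -> (#|A| <= M0 \/ D * (\sum_(x in A) defect A B x) <= #|A| ^ 2) ->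
  coverable A B S q.
Proof.
move=> Bm H; exists [:: A]; split.
- by rewrite /= expn_gt0.
- by move=> X; rewrite inE => /eqP ->; exists B.
- by move=> J [_ JA _ _]; exists A; rewrite ?inE.
Qed.

Lemma coverable_empty A B S q : m < #|B| -> coverable A B S q.
Proof.
move=> Bm; exists [::]; split => // J [_ _ BJ Jm].
by have := leq_trans Bm (leq_trans (subset_leq_card BJ) Jm); rewrite ltnn.
Qed.

Lemma coverable_reset A B S q : coverable A B set0 q -> coverable A B S q.
Proof.
move=> [C [sC gC HC]]; exists C; split => // J [SJ JA BJ Jm].
by apply: HC; split => //; rewrite sub0set.
Qed.

(** Either [a] is outside [J] and leaves [A], or it is in [J] and one unit of [q] is spent. The
    count closes because x^(q+1) + (x+1)^q <= (x+1)^(q+1), with x the size of [A]. *)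
Lemma coverable_branch A B S B' S' a q :
    a \in A ->
    (forall J, a \in J -> compatible A B S J -> compatible A B' S' J) ->
    coverable (A :\ a) B S q.+1 -> coverable A B' S' q ->
  coverable A B S q.+1.
Proof.
move=> aA comp [C1 [s1 g1 H1]] [C2 [s2 g2 H2]].
exists (C1 ++ C2); split.
- rewrite size_cat; apply: leq_trans (leq_add s1 s2) _.
  have -> : #|A :\ a|.+1 = #|A| by rewrite (cardsD1 a A) aA.
  rewrite [in X in _ <= X]expnS mulSn addnC leq_add2l expnS.
  by rewrite leq_mul2l; apply/orP; right; case: (q) => // e; rewrite leq_exp2r.
- by move=> X; rewrite mem_cat => /orP [/g1|/g2].
- move=> J cJ; have [aJ|aJ] := boolP (a \in J).
    by have [X XC JX] := H2 _ (comp _ aJ cJ); exists X; rewrite // mem_cat XC orbT.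
  have [|X XC JX] := H1 J; last by exists X; rewrite // mem_cat XC.
  case: cJ => SJ JA BJ Jm; split=> //.
  by rewrite subsetD1 JA.
Qed.

Definition gain (B : {set V}) (S : {set T}) (x : T) : nat :=
  #|[set y in S | add x y \notin B]|.

Definition energy (A : {set T}) B S := \sum_(x in A) gain B S x.

(** Double counting of the pairs from [A] and [S] with sum outside [B]: growth of [B] is read off
    from [gain], growth of [S] from [defect]. *)
Lemma energyE A B S : energy A B S = \sum_(x in S) defect A B x.
Proof.
rewrite /energy /gain /defect.
under eq_bigr do rewrite -sum1dep_card.
under [RHS]eq_bigr do rewrite -sum1dep_card.
rewrite (exchange_big_dep (mem S)) /=; last by move=> i j _ /andP [].
apply: eq_bigr => x xS; apply: eq_bigl => y.
by rewrite xS addC.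
Qed.

Lemma energy_setU1 A B S a : a \notin S ->
  energy A B (a |: S) = defect A B a + energy A B S.
Proof. by move=> aS; rewrite !energyE big_setU1. Qed.

Lemma energy_setD1 A B S a : a \in A ->
  energy A B S <= energy (A :\ a) B S + #|S|.
Proof.
move=> aA; rewrite /energy (big_setD1 a aA) /= addnC leq_add2l.
by apply: subset_leq_card; apply/subsetP => y; rewrite inE => /andP [].
Qed.

Lemma defect_mono A B B' x : B \subset B' ->
  defect A B x <= defect A B' x + #|B' :\: B|.
Proof.
move=> BB'; rewrite /defect.
rewrite -(card_imset [set y in A | add x y \notin B] (@addI x)).
rewrite -(card_imset [set y in A | add x y \notin B'] (@addI x)).
apply: leq_trans (leq_card_setU _ _); apply: subset_leq_card.
apply/subsetP => _ /imsetP [y + ->]; rewrite !inE => /andP [yA yB].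
rewrite yB /=; case: (boolP (add x y \in B')) => yB'; rewrite ?orbT // orbF.
by apply: imset_f; rewrite inE yA.
Qed.

Lemma energy_mono A B B' S : B \subset B' ->
  energy A B S <= energy A B' S + #|S| * #|B' :\: B|.
Proof.
move=> BB'; rewrite !energyE.
rewrite -sum_nat_const -big_split /=.
by apply: leq_sum => x _; apply: defect_mono.
Qed.

Lemma card_gain B S x :
  #|B :|: [set add x y | y in S]| = #|B| + gain B S x.
Proof.
rewrite /gain -(card_imset [set y in S | add x y \notin B] (@addI x)).
rewrite -cardsUI addnC [X in X + _](_ : _ = 0) ?add0n.
  apply: eq_card => z; rewrite !inE.
  case: (boolP (z \in B)) => //= zB.
  apply/imsetP/imsetP => -[y yS zE]; exists y => //.
    by rewrite inE yS -zE.
  by move: yS; rewrite inE => /andP [].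
apply: eq_card0 => z; rewrite !inE; apply/negbTE/negP => /andP [zB].
by move=> /imsetP [y]; rewrite inE => /andP [_ +] zE; rewrite -zE zB.
Qed.

Hypothesis D_gt0 : 0 < D.
Hypothesis g_gt0 : 0 < g.
Hypothesis gp : 4 * D * g <= p.
Hypothesis gM : 2 * D * g <= M0.
Hypothesis mM : m <= 4 * M0.

Definition slack (A : {set T}) (B : {set V}) := #|A| + (m - #|B|).

(* [S] is the set of elements of [J] selected in the current round, which started with [S] empty
   and slack [U0]; [c] bounds the cost of the later rounds. *)
Lemma coverable_round c U0 :
    (forall A B q, M0 < #|A| -> slack A B <= U0 -> #|A| <= 4 * D * (U0 - slack A B) ->
       c + (m.+1 - #|B|) <= g * q -> coverable A B set0 q) ->
  forall A B S q,
    #|S| <= p -> slack A B <= U0 ->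
    #|S| * #|A| <= 2 * D * (energy A B S + p * (U0 - slack A B)) ->
    g * (p - #|S|) + c + (m.+1 - #|B|) <= g * q ->
  coverable A B S q.
Proof.
move=> reset A B S q.
(* Removal from [A], growth of [B] and growth of [S] each lower this measure. A positive answer is
   worth [g]: it pays for one selection or for at least [g] new elements of [B]. *)
have [k] := ubnP (#|A| + (m - #|B|) + (p - #|S|)).
elim: k A B S q => // k IHk A B S q ltk Sp UU inv qge.
have [Bm|Bm] := ltnP m #|B|; first exact: coverable_empty.
have [AM|AM] := leqP #|A| M0; first by apply: coverable_stop; auto.
have [miss|miss] := leqP (D * (\sum_(x in A) defect A B x)) (#|A| ^ 2).
  by apply: coverable_stop; auto.
case: q qge => [|q] qge; first by move: qge; rewrite muln0 leqn0 addn_eq0 subn_eq0 ltnNge Bm andbF.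
(* Losing [a] costs at most [#|S| <= p] in energy and lowers the slack by 1, so the term
   [p * (U0 - slack A B)] absorbs it. *)
have remove a : a \in A -> coverable (A :\ a) B S q.+1.
  move=> aA; have cA := cardsD1 a A; rewrite aA add1n in cA.
  have EA := energy_setD1 B S aA.
  have sl : slack A B = (slack (A :\ a) B).+1 by rewrite /slack cA.
  apply: IHk => //; first by lia.
    by lia.
  apply: leq_trans (_ : #|S| * #|A| <= _); first by rewrite leq_mul2l cA leqnSn orbT.
  apply: leq_trans inv _; rewrite leq_mul2l; apply/orP; right.
  have -> : U0 - slack (A :\ a) B = (U0 - slack A B).+1 by lia.
  by rewrite mulnS; lia.
(* An [a] of large gain is queried first: if it is in [J], then [a + S] joins [B]. The energy drops
   by at most [#|S|] per new element of [B], again absorbed by the slack. *)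
case: (pickP [pred a in A | g <= gain B S a]) => [a /= /andP [aA ga]|noga].
  pose B' := B :|: [set add a y | y in S].
  have cB : #|B'| = #|B| + gain B S a by rewrite card_gain.
  apply: (coverable_branch (B' := B') (S' := S) aA) (remove a aA) _.
    move=> J aJ [SJ JA BJ Jm]; split => //; rewrite subUset BJ /=.
    apply/subsetP => _ /imsetP [y yS ->].
    by apply: imset2_f => //; apply: (subsetP SJ).
  have [B'm|B'm] := ltnP m #|B'|; first exact: coverable_empty.
  have BB' : B \subset B' by apply: subsetUl.
  have Em := energy_mono A S BB'.
  have cD : #|B' :\: B| = gain B S a by rewrite cardsDS // cB addKn.
  rewrite cD in Em.
  have sl : slack A B = slack A B' + gain B S a by rewrite /slack cB; lia.
  apply: IHk => //; first by lia.
  - by lia.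
  - apply: leq_trans inv _; rewrite leq_mul2l; apply/orP; right.
    have -> : U0 - slack A B' = U0 - slack A B + gain B S a by lia.
    have : #|S| * gain B S a <= p * gain B S a by rewrite leq_mul2r Sp orbT.
    by rewrite mulnDr; lia.
  - by rewrite mulnS in qge; lia.
have ltE : energy A B S <= g * #|A|.
  rewrite mulnC -sum_nat_const; apply: leq_sum => x xA.
  by have := noga x; rewrite /= xA /=; lia.
(* The round ends when [#|S| = p]: the energy is at most [g * #|A|] and [4 * D * g <= p], so the
   slack term carries half of [p * #|A|], that is, [#|A| <= 4 * D * (U0 - slack A B)]. *)
have [pS|Spp] := leqP p #|S|.
  apply: coverable_reset; apply: reset => //; last by lia.
  have Spe : #|S| = p by lia.
  have p_gt0 : 0 < p by nia.
  rewrite Spe in inv; rewrite -(leq_pmul2l p_gt0).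
  have h1 : 4 * D * g * #|A| <= p * #|A| by rewrite leq_mul2r gp orbT.
  have h2 : 2 * D * energy A B S <= 2 * D * (g * #|A|) by rewrite leq_mul2l ltE orbT.
  by move: (U0 - _) inv h1 h2 => w; nia.
(* Otherwise [S] would account for at most [g * #|A|] bad pairs and the rest for at most
   [#|A| ^ 2 / (2 * D)]; as [2 * D * g <= M0 < #|A|], this contradicts [miss]. *)
have [a aA /andP [aS da]] :
    exists2 a, a \in A & (a \notin S) && (#|A| <= 2 * D * defect A B a).
  case: (pickP [pred a in A | (a \notin S) && (#|A| <= 2 * D * defect A B a)]).
    by move=> a /= /andP [aA H]; exists a.
  move=> none; exfalso.
  have split_sum : \sum_(x in A) defect A B x <=
      energy A B S + \sum_(x in A :\: S) defect A B x.
    rewrite (big_setID S) /= leq_add2r energyE.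
    rewrite [X in _ <= X](big_setID A) /= setIC leq_addr //.
  have rest : 2 * D * \sum_(x in A :\: S) defect A B x <= #|A| * #|A|.
    rewrite big_distrr /=; apply: leq_trans (_ : \sum_(x in A :\: S) #|A| <= _).
      apply: leq_sum => x; rewrite inE => /andP [xS xA].
      by have := none x; rewrite /= xA xS /=; lia.
    by rewrite sum_nat_const leq_mul2r subset_leq_card ?subsetDl ?orbT.
  have h2 : 2 * D * energy A B S <= 2 * D * (g * #|A|) by rewrite leq_mul2l ltE orbT.
  have h3 : 2 * D * g * #|A| <= #|A| * #|A| by rewrite leq_mul2r; apply/orP; right; lia.
  move: miss split_sum; rewrite expnS expn1 => miss split_sum.
  have h4 : 2 * D * \sum_(x in A) defect A B x <=
     2 * D * (energy A B S + \sum_(x in A :\: S) defect A B x).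
    by rewrite leq_mul2l split_sum orbT.
  by nia.
have cS : #|a |: S| = #|S|.+1 by rewrite cardsU1 aS.
apply: (coverable_branch (B' := B) (S' := a |: S) aA) (remove a aA) _.
  by move=> J aJ [SJ JA BJ Jm]; split=> //; rewrite subUset sub1set aJ.
apply: IHk; rewrite ?cS //; first by lia.
- rewrite energy_setU1 // mulSn -addnA mulnDr.
  by apply: leq_add.
- have e : p - #|S| = (p - #|S|.+1).+1 by lia.
  by rewrite e !mulnS in qge; lia.
Qed.

(* At the end of a round the slack has dropped by a factor [20 D / (20 D + 1)]. *)
Lemma coverable_rounds r A B U0 q :
    slack A B <= U0 -> U0 * (20 * D) ^ r <= (20 * D).+1 ^ r ->
    g * (p * r.+1) + (m.+1 - #|B|) <= g * q ->
  coverable A B set0 q.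
Proof.
elim: r A B U0 q => [|r IHr] A B U0 q UU Ur qge.
all: apply: (@coverable_round (g * (p * _)) U0); rewrite ?cards0 ?subn0 //.
(* Here [U0 <= 1], so a nonempty [A'] has slack exactly [U0] and the round cannot have ended. *)
1: { move=> A' B' q' AM UU' A'le _; exfalso.
  move: Ur; rewrite !expn0 => Ur; move: UU' A'le; rewrite /slack => UU' A'le.
  have e : U0 - (#|A'| + (m - #|B'|)) = 0 by lia.
  by rewrite e in A'le; lia. }
1: by rewrite mulnS mulnDr in qge; exact: qge.
2: by rewrite mulnS mulnDr in qge; exact: qge.
move=> A' B' q' AM UU' A'le q'ge.
apply: IHr (leqnn _) _ q'ge.
(* As [m <= 4 * M0 < 4 * #|A'|], the bound [A'le] makes the slack at most [20 * D] times its
   drop. *)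
have s5 : slack A' B' <= 5 * #|A'| by rewrite /slack; lia.
have h : (20 * D).+1 * slack A' B' <= 20 * D * U0.
  by move: A'le s5 UU'; move: (slack A' B') #|A'| => u a; nia.
rewrite -(leq_pmul2l (isT : 0 < (20 * D).+1)) -expnS.
apply: leq_trans Ur; rewrite mulnA expnS.
by rewrite [X in _ <= X](_ : _ = 20 * D * U0 * (20 * D) ^ r) ?leq_mul2r ?h ?orbT //; lia.
Qed.

Lemma container_family r q (A : {set T}) :
    (#|A| + m) * (20 * D) ^ r <= (20 * D).+1 ^ r ->
    g * (p * r.+1) + m.+1 <= g * q ->
  exists C : seq {set T},
    [/\ size C <= #|A|.+1 ^ q, {in C, forall X, good_container X} &
        forall J, J \subset A -> #|add @2: (J, J)| <= m -> exists2 X, X \in C & J \subset X].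
Proof.
move=> Ur qge.
have sl : slack A set0 <= #|A| + m by rewrite /slack cards0 subn0.
rewrite -[m.+1]subn0 -(cards0 V) in qge.
have [C [sC gC HC]] := coverable_rounds sl Ur qge.
by exists C; split=> // J JA Jm; apply: HC; split; rewrite ?sub0set.
Qed.

End Containers.

Lemma card_setC_le (T : finType) (A : {set T}) (P : pred T) (u : nat) :
  #|[set y in A | ~~ P y]| <= u -> #|A| <= #|[set y in A | P y]| + u.
Proof.
move=> H; rewrite -(cardsID [set y | P y] A).
apply: leq_add; first by apply: subset_leq_card; apply/subsetP => y; rewrite !inE.
apply: leq_trans H; apply: subset_leq_card; apply/subsetP => y.
by rewrite !inE andbC.
Qed.

(** * Robust inverse theorem for doubling close to 2 *)

Section NearSubgroup.
Local Open Scope group_scope.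
Variables (gT : finGroupType) (R C : {set gT}) (u w : nat).
Hypothesis mulgC : forall x y : gT, x * y = y * x.
Hypothesis R_defect : {in R, forall x, #|[set y in R | x * y \notin C]| <= u}.
Hypothesis C_small : #|C| + 2 * u + w <= 2 * #|R|.
Hypothesis w_large : #|R| < 2 * w.

Let H := [set x * y^-1 | x in R, y in R].

(** For [h = x / x'], the good parts of [x R] and [x' R] have at least [#|R| - u] elements each and
    lie in [C], so they share [w] points; a common point [x y = x' y'] gives [y h = y']. *)
Lemma many_quotients h : h \in H -> w <= #|[set y in R | y * h \in R]|.
Proof.
case/imset2P => x x' xR x'R ->.
pose Y z := [set y in R | z * y \in C].
have sY z : z \in R -> #|R| <= #|mulg z @: Y z| + u.
  by move=> zR; rewrite card_imset; [apply: card_setC_le; apply: R_defect | apply: mulgI].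
have YC z : mulg z @: Y z \subset C.
  by apply/subsetP => _ /imsetP [y + ->]; rewrite inE => /andP [].
pose I := (mulg x @: Y x) :&: (mulg x' @: Y x').
have I_big : w <= #|I|.
  have := cardsUI (mulg x @: Y x) (mulg x' @: Y x'); rewrite -/I.
  have : #|mulg x @: Y x :|: mulg x' @: Y x'| <= #|C|.
    by apply: subset_leq_card; rewrite subUset !YC.
  by have := sY _ xR; have := sY _ x'R; lia.
apply: leq_trans I_big _; rewrite -(card_imset _ (mulgI x^-1)).
apply: subset_leq_card; apply/subsetP => _ /imsetP [z zI ->].
case/setIP: zI => /imsetP [y + zy] /imsetP [y' + zy'].
rewrite !inE => /andP [yR _] /andP [y'R _].
rewrite zy mulKg yR /=.
by rewrite mulgA (mulgC y) -zy zy' mulgC mulKg.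
Qed.

(** The argument of Freiman's 3/2 theorem: more than half of the [y] in [R] have [y h1] in [R], and
    likewise for [h2^-1], so some [y] serves both and [h1 h2 = (y h1) (y h2^-1)^-1] is a quotient.
    Counting the pairs [(y, y h)] in [R x R] bounds the order. *)
Lemma near_subgroup :
  exists G : {group gT}, {in R &, forall x y, x * y^-1 \in G} /\ #|G| * w <= #|R| ^ 2.
Proof.
have R_gt0 : 0 < #|R| by lia.
have HV h : h \in H -> h^-1 \in H.
  by case/imset2P => x y xR yR ->; rewrite invMg invgK; apply: imset2_f.
have gH : group_set H.
  apply/group_setP; split.
    by case/card_gt0P: R_gt0 => x xR; apply/imset2P; exists x x; rewrite ?mulgV.
  move=> h1 h2 h1H /HV h2H.
  pose Y h := [set y in R | y * h \in R].
  have c1 : w <= #|Y h1| := many_quotients h1H.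
  have c2 : w <= #|Y h2^-1| := many_quotients h2H.
  have: 0 < #|Y h1 :&: Y h2^-1|.
    have := cardsUI (Y h1) (Y h2^-1).
    have : #|Y h1 :|: Y h2^-1| <= #|R|.
      by apply: subset_leq_card; apply/subsetP => y; rewrite !inE => /orP [] /andP [].
    by move: c1 c2 w_large; lia.
  case/card_gt0P => y; rewrite !inE => /andP [/andP [_ y1] /andP [_ y2]].
  apply/imset2P; exists (y * h1) (y * h2^-1) => //.
  by rewrite invMg invgK (mulgC y h1) -mulgA (mulgC h2) mulKVg.
exists (group gH); split; first by move=> x y xR yR; apply: imset2_f.
rewrite /= -sum_nat_const expnS expn1 -cardsX.
apply: (@leq_trans (\sum_(h in H) #|[set y in R | (y * h)%g \in R]|)).
  by apply: leq_sum => h; apply: many_quotients.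
under eq_bigr do rewrite -sum1dep_card.
rewrite pair_big_dep /= sum1dep_card.
have fI : injective (fun hy : gT * gT => (hy.2, hy.2 * hy.1)).
  by move=> [h y] [h' y'] /= [-> /mulgI ->].
rewrite -(card_imset _ fI); apply: subset_leq_card.
apply/subsetP => _ /imsetP [[h y] + ->]; rewrite !inE /=.
by case/andP => _.
Qed.

End NearSubgroup.

(** The codomain is large enough for [inord] never to take its default value, so these are sums of
    integers. *)
Definition add_ord n (x y : 'I_n.+1) : 'I_(n + n).+1 := inord (x + y).

Lemma add_ordE n (x y : 'I_n.+1) : add_ord x y = x + y :> nat.
Proof. by rewrite inordK // ltnS leq_add // -ltnS ltn_ord. Qed.

Lemma add_ordC n : commutative (@add_ord n).
Proof. by move=> x y; rewrite /add_ord addnC. Qed.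

Lemma add_ordI n : right_injective (@add_ord n).
Proof.
move=> x y z /(congr1 (@nat_of_ord _)); rewrite !add_ordE => /addnI.
exact: val_inj.
Qed.

(* Modulo [N = max A - min A] the set [A] loses one element while [B] loses about [#|A|] of them,
   so [A] has doubling close to 1 in Z/N and lies in a subgroup of size about [#|A|]. *)
Lemma robust_freiman n (A : {set 'I_n.+1}) (B : {set 'I_(n + n).+1}) m u k :
    #|A| = k.+1 -> 0 < k -> #|B| <= m ->
    {in A, forall x, defect (@add_ord n) A B x <= u} ->
  2 * k <= m + 3 * u /\
  forall w, m + 4 * u + w <= 3 * k -> k < 2 * w ->
    exists a d h : nat,
      {in A, forall x : 'I_n.+1, exists2 j, j <= h & x = a + d * j :> nat} /\ h * w <= k ^ 2.
Proof.
move=> cA k_gt0 Bm dA.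
have [x2 x2A] : exists x2, x2 \in A by apply/card_gt0P; rewrite cA.
pose x0 := [arg min_(x < x2 in A) val x].
pose x1 := [arg max_(x > x2 in A) val x].
have [x0A x0min] : x0 \in A /\ forall y, y \in A -> x0 <= y by rewrite /x0; case: arg_minnP.
have [x1A x1max] : x1 \in A /\ forall y, y \in A -> y <= x1 by rewrite /x1; case: arg_maxnP.
pose A1 := A :\ x1.
have cA1 : #|A1| = k by have := cardsD1 x1 A; rewrite x1A cA -/A1; lia.
have A1A x : x \in A1 -> x \in A by rewrite inE => /andP [].
have A1lt x : x \in A1 -> x < x1.
  rewrite !inE => /andP [xx1 /x1max]; rewrite leq_eqVlt => /orP [/eqP /val_inj e|//].
  by rewrite e eqxx in xx1.
have [x3 x3A] : exists x3, x3 \in A1 by apply/card_gt0P; rewrite cA1.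
have x01 : x0 < x1 by apply: leq_ltn_trans (x0min _ (A1A _ x3A)) (A1lt _ x3A).
have x0A1 : x0 \in A1.
  by rewrite !inE x0A andbT; apply/eqP => e; rewrite e ltnn in x01.
(* With this [N], the group ['I_N.+1] is Z/(x1 - x0), where [x0] and [x1] coincide; leaving out [x1]
   keeps [rho] injective. *)
pose N := (x1 - x0).-1.
have NE : N.+1 = x1 - x0 by rewrite /N; lia.
pose rho (x : 'I_n.+1) : 'I_N.+1 := inord (x - x0).
have rhoE x : x \in A1 -> rho x = x - x0 :> nat.
  move=> xA; rewrite inordK // NE; have := A1lt _ xA.
  by have := x0min _ (A1A _ xA); lia.
have rhoI : {in A1 &, injective rho}.
  move=> x y xA yA /(congr1 (@nat_of_ord _)); rewrite !rhoE // => e; apply: val_inj => /=.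
  by have := x0min _ (A1A _ xA); have := x0min _ (A1A _ yA); lia.
(* Truncation is harmless: sums of two elements of [A] are at least [2 * x0], and other elements of
   [B] only count towards the size of [C]. *)
pose pi (c : 'I_(n + n).+1) : 'I_N.+1 := inord ((c - 2 * x0) %% N.+1).
have piE c : pi c = (c - 2 * x0) %% N.+1 :> nat by rewrite inordK // ltn_mod.
pose R := rho @: A1; pose C := pi @: B.
have cR : #|R| = k by rewrite card_in_imset.
have rhoM x y : x \in A1 -> y \in A1 -> (rho x * rho y)%g = pi (add_ord x y).
  move=> xA yA; apply: val_inj; rewrite /= piE !rhoE // add_ordE; congr (_ %% _).
  by have := x0min _ (A1A _ xA); have := x0min _ (A1A _ yA); lia.
have A1_defect x : x \in A -> #|[set y in A1 | add_ord x y \notin B]| <= u.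
  move=> xA; apply: leq_trans (dA _ xA); apply: subset_leq_card.
  by apply/subsetP => y; rewrite !inE => /andP [/andP [_ ->] ->].
have R_defect : {in R, forall x, #|[set y in R | (x * y)%g \notin C]| <= u}.
  move=> _ /imsetP [x xA ->]; apply: leq_trans (A1_defect x (A1A _ xA)).
  apply: leq_trans (leq_imset_card rho _); apply: subset_leq_card.
  apply/subsetP => _ /setIdP [/imsetP [y yA ->] H].
  apply: imset_f; rewrite inE yA; apply: contra H => H.
  by rewrite rhoM //; apply: imset_f.
have C_card : #|C| + k <= m + 2 * u.
  pose Y := [set y in A1 | (add_ord x0 y \in B) && (add_ord x1 y \in B)].
  have cY : k <= #|Y| + 2 * u.
    rewrite -cA1; apply: card_setC_le.
    have := leq_add (A1_defect _ x0A) (A1_defect _ x1A).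
    rewrite [u + u]addnn -mul2n; apply: leq_trans.
    apply: leq_trans (leq_card_setU _ _); apply: subset_leq_card.
    apply/subsetP => y; rewrite !inE => /andP [->] /=.
    by rewrite negb_and.
  have YB : add_ord x1 @: Y \subset B.
    by apply/subsetP => _ /imsetP [y + ->]; rewrite inE => /andP [_ /andP []].
  have CE : C \subset pi @: (B :\: add_ord x1 @: Y).
    apply/subsetP => _ /imsetP [c cB ->].
    have [/imsetP [y yY ->]|cY'] := boolP (c \in add_ord x1 @: Y); last first.
      by apply: imset_f; rewrite inE cY'.
    move: (yY); rewrite inE => /andP [yA /andP [y0 y1]].
    have -> : pi (add_ord x1 y) = pi (add_ord x0 y).
      apply: val_inj; rewrite /= !piE !add_ordE.
      have := x0min _ (A1A _ yA) => h.
      have -> : x1 + y - 2 * x0 = (x0 + y - 2 * x0) + N.+1 by rewrite NE; clear -h x01; lia.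
      by rewrite modnDr.
    (* The representative [x0 + y] is not itself dropped, as [x0 + y < x0 + x1 <= x1 + z]. *)
    apply: imset_f; rewrite inE y0 andbT; apply/imsetP => -[z zY].
    move/(congr1 (@nat_of_ord _)); rewrite !add_ordE.
    have zA : z \in A1 by move: zY; rewrite inE => /andP [].
    by move: (A1lt _ yA) (x0min _ (A1A _ zA)); clear; lia.
  have := leq_trans (subset_leq_card CE) (leq_imset_card _ _).
  rewrite cardsDS //; have := subset_leq_card YB.
  rewrite !(card_imset _ (@add_ordI n x1)).
  by move: cY Bm; move: #|Y| #|B| #|C| => y b c; clear; lia.
split.
  have : k <= #|[set y in R | (rho x0 * y)%g \in C]| + u.
    by rewrite -cR; apply: card_setC_le; apply: R_defect; apply: imset_f.
  have : #|[set y in R | (rho x0 * y)%g \in C]| <= #|C|.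
    rewrite -(card_imset _ (mulgI (rho x0))); apply: subset_leq_card.
    by apply/subsetP => _ /imsetP [y + ->]; rewrite inE => /andP [].
  by lia.
move=> w w1 w2.
have ZpC (x y : 'I_N.+1) : (x * y = y * x)%g by apply: val_inj; rewrite /= addnC.
have w1' : #|C| + 2 * u + w <= 2 * #|R|.
  by rewrite cR; move: w1 C_card; move: #|C| => c; clear; lia.
have w2' : #|R| < 2 * w by rewrite cR.
have [G [RG cG]] := near_subgroup ZpC R_defect w1' w2'.
have GdvN : #|G| %| N.+1 by have := cardSg (subsetT G); rewrite cardsT card_ord.
(* The subgroup of order h of the cyclic group of order [N.+1] consists of the multiples of
   [N.+1 / h]; the omitted [x1] is the term [j = h]. *)
exists x0, (N.+1 %/ #|G|), #|G|; split; last by rewrite -cR.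
have dE : N.+1 = N.+1 %/ #|G| * #|G| by rewrite divnK.
move=> x xA; have [->|xx1] := eqVneq x x1.
  by exists #|G| => //; rewrite -dE NE subnKC // ltnW.
have xA1 : x \in A1 by rewrite !inE xx1.
have rG : rho x \in G.
  have := RG _ _ (imset_f rho xA1) (imset_f rho x0A1).
  suff -> : rho x0 = 1%g by rewrite invg1 mulg1.
  by apply: val_inj; rewrite /= rhoE // subnn.
have e1 : (rho x ^+ #|G|)%g = 1%g.
  by apply/eqP; rewrite -order_dvdn order_dvdG.
have dv : N.+1 %| rho x * #|G|.
  by move/(congr1 (@nat_of_ord _)): e1; rewrite Zp_expg /= => /eqP.
have dv' : N.+1 %/ #|G| %| rho x by rewrite -(dvdn_pmul2r (cardG_gt0 G)) -dE.
case/dvdnP: dv' => j jE; exists j; last first.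
  by rewrite mulnC -jE rhoE // subnKC // x0min.
have d_gt0 : 0 < N.+1 %/ #|G| by rewrite divn_gt0 ?cardG_gt0 // dvdn_leq.
by rewrite -(leq_pmul2r d_gt0) -jE mulnC -dE ltnW // ltn_ord.
Qed.

(** * Counting *)

Lemma card_draws_through (T : finType) (A U : {set T}) s : U \subset A ->
  #|[set J : {set T} | [&& U \subset J, J \subset A & #|J| == s]]| <= 'C(#|A| - #|U|, s - #|U|).
Proof.
move=> UA; rewrite -(cardsDS UA) -cards_draws.
have inj : {in [set J : {set T} | [&& U \subset J, J \subset A & #|J| == s]] &,
    injective (fun J => J :\: U)}.
  move=> J J'; rewrite !inE => /and3P [UJ _ _] /and3P [UJ' _ _] e.
  by rewrite -(setID J U) -(setID J' U) e (setIidPr UJ) (setIidPr UJ').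
rewrite -(card_in_imset inj); apply: subset_leq_card.
apply/subsetP => _ /imsetP [J + ->]; rewrite !inE => /and3P [UJ JA /eqP <-].
by rewrite cardsDS // setSD //=.
Qed.

(** Each such [J] contains a [t]-subset [U] of [X]; this is the union bound over [U]. *)
Lemma card_heavy_draws (T : finType) (A X : {set T}) s t : X \subset A ->
  #|[set J : {set T} | [&& J \subset A, #|J| == s & t <= #|J :&: X|]]|
    <= 'C(#|X|, t) * 'C(#|A| - t, s - t).
Proof.
move=> XA; rewrite -cards_draws -sum_nat_const.
pose W := [set U : {set T} | U \subset X & #|U| == t].
apply: (@leq_trans
  #|\bigcup_(U in W) [set J : {set T} | [&& U \subset J, J \subset A & #|J| == s]]|).
  apply: subset_leq_card; apply/subsetP => J; rewrite inE => /and3P [JA Js tJ].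
  have: 0 < #|[set U : {set T} | U \subset J :&: X & #|U| == t]| by rewrite cards_draws bin_gt0.
  case/card_gt0P => U; rewrite inE subsetI => /andP [/andP [UJ UX] Ut].
  by apply/bigcupP; exists U; rewrite inE ?UX ?UJ ?JA.
apply: (big_rec2 (fun (Y : {set {set T}}) c => #|Y| <= c)) => [|U y Y]; first by rewrite cards0.
rewrite inE => /andP [UX /eqP Ut] Yy; apply: leq_trans (leq_card_setU _ _) _.
apply: leq_add Yy; rewrite -Ut; apply: card_draws_through.
exact: subset_trans UX XA.
Qed.

(** The quotient of the binomials is the product of (s - i)/(a - i) over i < t, each factor being at
    most s/a. *)
Lemma bin_sub_ratio a s t : t <= s -> s <= a ->
  'C(a - t, s - t) * a ^ t <= 'C(a, s) * s ^ t.
Proof.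
move=> + sa; elim: t => [|t IHt] ts; first by rewrite !subn0.
have {IHt} IH := IHt (ltnW ts).
have e2 : s - t = (s - t.+1).+1 by lia.
have := mul_bin_diag (a - t) (s - t.+1); rewrite -e2 -subnS => D.
have st_gt0 : 0 < s - t by lia.
rewrite -(leq_pmul2l st_gt0) !expnS.
have h1 : a * (s - t) <= (a - t) * s by nia.
apply: (@leq_trans ((a - t) * s * ('C(a - t.+1, s - t.+1) * a ^ t))).
  rewrite [X in X <= _](_ : _ = a * (s - t) * ('C(a - t.+1, s - t.+1) * a ^ t)); last by lia.
  by rewrite leq_mul2r h1 orbT.
rewrite [X in X <= _](_ : _ = s * ((a - t) * 'C(a - t.+1, s - t.+1)) * a ^ t); last by lia.
rewrite D [X in X <= _](_ : _ = s * (s - t) * ('C(a - t, s - t) * a ^ t)); last by lia.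
rewrite [X in _ <= X](_ : _ = s * (s - t) * ('C(a, s) * s ^ t)); last by lia.
by rewrite leq_mul2l IH orbT.
Qed.

Lemma leq_bin_ratio x y s a b : (forall i, i < s -> (x - i) * a <= (y - i) * b) ->
  'C(x, s) * a ^ s <= 'C(y, s) * b ^ s.
Proof.
move=> H; rewrite -(leq_pmul2r (fact_gt0 s)).
rewrite mulnAC bin_ffact [X in _ <= X]mulnAC bin_ffact !ffact_prod.
rewrite -[in a ^ s](card_ord s) -[in b ^ s](card_ord s) -!prod_nat_const -!big_split /=.
by apply: leq_prod => i _; apply: H.
Qed.

Lemma cover_union (T : finType) (Good adm : {set T} -> Prop) (b : nat) (C : seq {set T}) :
    {in C, forall X : {set T}, exists F : {set {set T}}, #|F| <= b /\
       forall J : {set T}, adm J -> J \subset X -> J \in F \/ Good J} ->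
  exists F : {set {set T}}, #|F| <= size C * b /\
    forall J X, adm J -> X \in C -> J \subset X -> J \in F \/ Good J.
Proof.
elim: C => [|X C IHC] H; first by exists set0; rewrite cards0.
have [F1 [c1 H1]] := H X (mem_head _ _).
have [|F2 [c2 H2]] := IHC; first by move=> Y YC; apply: H; rewrite inE YC orbT.
exists (F1 :|: F2); split.
  by apply: leq_trans (leq_card_setU _ _) _; rewrite /= mulSn leq_add.
move=> J Y aJ; rewrite inE => /orP [/eqP ->|YC] JY.
  by have [JF|] := H1 J aJ JY; [left; rewrite inE JF | right].
by have [JF|] := H2 J Y aJ YC JY; [left; rewrite inE JF orbT | right].
Qed.

Definition in_short_AP n (S : {set 'I_n.+1}) (L : nat) :=
  exists a d : nat, {in S, forall x : 'I_n.+1, exists2 j, j < L & x = a + d * j :> nat}.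

(** By Markov's inequality, a proportion [1 / Q ^ 2] of bad pairs leaves at most [#|A| / Q] elements
    with more than [#|A| / Q] bad sums. These form [X]; [F] collects the sets with at least [t]
    elements in [X], and for the others [T = J :&: X] is removed and [robust_freiman] applies to
    [A :\: X]. *)
Lemma large_container n (A : {set 'I_n.+1}) (B : {set 'I_(n + n).+1}) m Q s t :
    0 < Q -> #|B| <= m ->
    Q ^ 2 * (\sum_(x in A) defect (@add_ord n) A B x) <= #|A| ^ 2 ->
    2 * m + 13 * (#|A| %/ Q) + 5 < 5 * #|A| ->
  2 * #|A| <= m + 5 * (#|A| %/ Q) + 2 /\
  exists F : {set {set 'I_n.+1}},
    #|F| <= 'C(#|A| %/ Q, t) * 'C(#|A| - t, s - t) /\
    forall J : {set 'I_n.+1}, #|J| = s -> J \subset A -> J \in F \/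
      exists T : {set 'I_n.+1}, [/\ T \subset J, #|T| < t &
        in_short_AP (J :\: T) (2 * m + 11 * (#|A| %/ Q) + 4 - 3 * #|A|)].
Proof.
move=> Q_gt0 Bm miss large; set u := #|A| %/ Q in large *.
pose X := [set x in A | #|A| < Q * defect (@add_ord n) A B x].
have XA : X \subset A by apply/subsetP => x; rewrite inE => /andP [].
have A_gt0 : 0 < #|A| by lia.
have cX : #|X| <= u.
  rewrite leq_divRL // -(leq_pmul2r A_gt0) -mulnA.
  apply: (@leq_trans (Q ^ 2 * \sum_(x in X) defect (@add_ord n) A B x)); last first.
    rewrite mulnn; apply: leq_trans miss; rewrite leq_mul2l; apply/orP; right.
    by rewrite [X in _ <= X](big_setID X) /= (setIidPr XA) leq_addr.
  rewrite -sum_nat_const big_distrr /=; apply: leq_sum => x.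
  by rewrite inE => /andP [_ xX]; rewrite expnS expn1 -mulnA leq_mul2l ltnW ?orbT.
pose k := #|A :\: X|.-1.
have cAX : #|A :\: X| = #|A| - #|X| by rewrite cardsDS.
have kE : #|A :\: X| = k.+1 by rewrite /k cAX; lia.
have dAX : {in A :\: X, forall x, defect (@add_ord n) (A :\: X) B x <= u}.
  move=> x; rewrite !inE => /andP [+ xA]; rewrite xA /= -leqNgt => h.
  rewrite leq_divRL // mulnC; apply: leq_trans h; rewrite leq_mul2l; apply/orP; right.
  by apply: subset_leq_card; apply/subsetP => y; rewrite !inE => /andP [/andP [_ ->] ->].
have k_gt0 : 0 < k by lia.
have [k_le kAP] := robust_freiman kE k_gt0 Bm dAX.
have ak : #|A| <= k + u + 1 by lia.
split; first by lia.
have [||a [d [h [AP hw]]]] := kAP (3 * k - m - 4 * u); try by lia.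
(* For v = m + 4u - 2k the chosen [w] is k - v and the claim is h <= k + 2v. It follows from (k +
   2v)(k - v) = k^2 + v(k - 2v) >= k^2. *)
have h_le : h <= 2 * m + 8 * u - 3 * k.
  rewrite leqNgt; apply/negP => h_gt.
  have := leq_mul h_gt (leqnn (3 * k - m - 4 * u)).
  have [v vE] : exists v, m + 4 * u = 2 * k + v by exists (m + 4 * u - 2 * k); lia.
  have -> : 3 * k - m - 4 * u = k - v by lia.
  have -> : (2 * m + 8 * u - 3 * k).+1 = k + 2 * v + 1 by lia.
  move: hw; have -> : 3 * k - m - 4 * u = k - v by lia.
  have vk : 2 * v < k by lia.
  by rewrite expnS expn1; nia.
exists [set J : {set 'I_n.+1} | [&& J \subset A, #|J| == s & t <= #|J :&: X|]]; split.
  apply: leq_trans (card_heavy_draws _ _ XA) _.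
  by rewrite leq_mul2r leq_bin2l ?orbT.
move=> J Js JA; have [tJ|tJ] := leqP t #|J :&: X|; [left | right].
  by rewrite inE JA Js eqxx.
exists (J :&: X); split => //; first exact: subsetIl.
exists a, d => x; rewrite !inE => /andP [+ xJ]; rewrite xJ (subsetP JA) //= => xX.
have xAX : x \in A :\: X by rewrite !inE (subsetP JA) //= xX.
have [j jh xE] := AP x xAX; exists j => //.
move: jh h_le k_le ak; rewrite -/u; by move: #|A| => c; clear; lia.
Qed.

(** * Real estimates for powers and binomial coefficients *)

Local Open Scope R_scope.

Lemma INR_leq a b : (a <= b)%N -> INR a <= INR b.
Proof. by move/leP; apply: le_INR. Qed.

Lemma INR_addn a b : INR (a + b)%N = INR a + INR b.
Proof. exact: plus_INR. Qed.

Lemma INR_muln a b : INR (a * b)%N = INR a * INR b.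
Proof. exact: mult_INR. Qed.

Lemma INR_expn a k : INR (a ^ k)%N = INR a ^ k.
Proof. by elim: k => [|k IH] //=; rewrite expnS INR_muln IH. Qed.

Lemma leq_of_INR a b : INR a <= INR b -> (a <= b)%N.
Proof. by move/INR_le/leP. Qed.

Lemma ltn_of_INR a b : INR a < INR b -> (a < b)%N.
Proof. by move/INR_lt/ltP. Qed.

Lemma floorP x : 0 <= x -> exists k : nat, INR k <= x < INR k + 1.
Proof.
move=> x0; have [up1 up2] := archimed x.
have up_gt0 : (0 < up x)%Z by apply: lt_IZR; lra.
exists (Z.to_nat (up x - 1)).
rewrite INR_IZR_INZ Z2Nat.id; last by lia.
by rewrite minus_IZR; lra.
Qed.

Lemma ratio_pow x a b c C t : 0 < a -> 0 <= b -> 0 <= C -> b <= c * a ->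
  x * a ^ t <= b ^ t * C -> x <= c ^ t * C.
Proof.
move=> a0 b0 C0 bc H; have at0 := pow_lt a t a0.
apply: (Rmult_le_reg_r (a ^ t)) => //; apply: Rle_trans H _.
have : b ^ t <= (c * a) ^ t by apply: pow_incr.
by rewrite Rpow_mult_distr; nra.
Qed.

Lemma exp_mul_INR d k : exp (d * INR k) = exp d ^ k.
Proof.
elim: k => [|k IH]; first by rewrite Rmult_0_r exp_0.
by rewrite S_INR Rmult_plus_distr_l Rmult_1_r exp_plus IH /=; ring.
Qed.

Lemma pow_le_exp c d k : 0 <= c -> c <= 1 + d -> c ^ k <= exp (d * INR k).
Proof.
move=> c0 cd; rewrite exp_mul_INR; apply: pow_incr; split=> //.
by apply: Rle_trans cd _; apply: exp_ineq1_le.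
Qed.

(** Induction with (1 + 1/t)^t <= exp 1 <= 3. *)
Lemma pow_self_le_fact t : INR t ^ t <= 3 ^ t * INR t`!.
Proof.
elim: t => [|t IH]; first by rewrite fact0 /=; lra.
rewrite factS INR_muln.
have [->|t_gt0] := posnP t; first by rewrite fact0 /=; lra.
have tR : 1 <= INR t by rewrite -[1]/(INR 1); apply: INR_leq.
have h : INR t.+1 ^ t <= 3 * INR t ^ t.
  have -> : INR t.+1 = (1 + / INR t) * INR t by rewrite S_INR; field; lra.
  rewrite Rpow_mult_distr; apply: Rmult_le_compat_r; first by apply: pow_le; lra.
  apply: Rle_trans (pow_le_exp t _ (Rle_refl _)) _.
    by have := Rinv_0_lt_compat (INR t); lra.
  by rewrite Rinv_l; [exact: exp_le_3 | lra].
rewrite -!tech_pow_Rmult.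
have t1 : 0 <= INR t.+1 by apply: pos_INR.
have := Rmult_le_compat_l _ _ _ t1 h.
have := Rmult_le_compat_l _ _ _ t1 IH.
lra.
Qed.

Lemma bin_le_pow u t : INR 'C(u, t) * INR t ^ t <= (3 * INR u) ^ t.
Proof.
have h : INR 'C(u, t) * INR t`! <= INR u ^ t.
  rewrite -INR_muln -INR_expn; apply: INR_leq; rewrite bin_ffact ffact_prod.
  rewrite -[in X in (_ <= X)%N](card_ord t) -prod_nat_const.
  by apply: leq_prod => i _; apply: leq_subr.
have h2 := Rmult_le_compat_l _ _ _ (pos_INR 'C(u, t)) (pow_self_le_fact t).
apply: Rle_trans h2 _; rewrite Rpow_mult_distr.
have : 0 <= 3 ^ t by apply: pow_le; lra.
nra.
Qed.

(** Bernoulli's inequality (1 + 1/b)^b >= 2; for [b = 20 * D] it says that [20 * D] rounds halve the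
    slack. *)
Lemma double_pow_succ b : (0 < b)%N -> (2 * b ^ b <= b.+1 ^ b)%N.
Proof.
have H k : ((b + k) * b ^ k <= b * b.+1 ^ k)%N.
  elim: k => [|k IH]; first by rewrite addn0.
  rewrite !expnS mulnCA [X in (_ <= X)%N]mulnCA.
  apply: leq_trans (_ : b.+1 * ((b + k) * b ^ k) <= _)%N; last by rewrite leq_mul2l IH orbT.
  by rewrite !mulnA leq_mul2r; apply/orP; right; lia.
by move=> b_gt0; have := H b; rewrite addnn -mul2n mulnAC mulnC leq_pmul2l.
Qed.

Lemma bin_shrink l M c s : 0 <= c -> c <= 1 -> (0 < l)%N ->
  INR M <= (1 - c) * INR l ->
  INR 'C(M, s) <= exp (- c * INR s) * INR 'C(l, s).
Proof.
move=> c0 c1 l0 Ml.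
have lR : 0 < INR l by apply: (lt_INR 0); apply/ltP.
have Ml' : (M <= l)%N by apply: leq_of_INR; nra.
have := @leq_bin_ratio M l s l M _.
move/(_ _)/INR_leq; rewrite !INR_muln !INR_expn => H.
have {}H : INR 'C(M, s) * INR l ^ s <= INR M ^ s * INR 'C(l, s).
  by rewrite [X in _ <= X]Rmult_comm; apply: H => i _; nia.
have := ratio_pow lR (pos_INR _) (pos_INR _) Ml H.
have := @pow_le_exp (1 - c) (- c) s ltac:(lra) ltac:(lra).
by have := pos_INR 'C(l, s); nra.
Qed.

(** Each factor (a - i)/(l - i) with i < s is at most 1 + x/(l - s) <= 1 + c. *)
Lemma bin_grow l a x c s : 0 <= c -> (s < l)%N -> (a <= l + x)%N ->
  INR x <= c * (INR l - INR s) ->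
  INR 'C(a, s) <= exp (c * INR s) * INR 'C(l, s).
Proof.
move=> c0 sl al xc.
have lR : 0 < INR (l - s) by apply: (lt_INR 0); apply/ltP; rewrite subn_gt0.
have lE : INR (l - s) = INR l - INR s by rewrite -[in RHS](subnK (ltnW sl)) INR_addn; lra.
have := @leq_bin_ratio a l s (l - s) (l - s + x) _.
move/(_ _)/INR_leq; rewrite !INR_muln !INR_expn => H.
have {}H : INR 'C(a, s) * INR (l - s) ^ s <= INR (l - s + x) ^ s * INR 'C(l, s).
  rewrite [X in _ <= X]Rmult_comm; apply: H => i is_.
  have [w wE] : exists w, l = (i + (l - s) + w)%N by exists (s - i)%N; lia.
  have -> : (l - i = l - s + w)%N by lia.
  have : (a - i <= l - s + w + x)%N by lia.
  by move: (l - s)%N (a - i)%N => b d h; nia.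
have h : INR (l - s + x) <= (1 + c) * INR (l - s) by rewrite INR_addn lE; nra.
have := ratio_pow lR (pos_INR _) (pos_INR _) h H.
have := @pow_le_exp (1 + c) c s ltac:(lra) ltac:(lra).
by have := pos_INR 'C(l, s); nra.
Qed.

(** The quotient is at most (3u/t)^t (s/a)^t <= 9^(-t), and 9 >= exp 2; hence 27 = 3 * 9. *)
Lemma heavy_bin a u s t : (0 < t)%N -> (t <= s)%N -> (s <= a)%N ->
  27 * INR u * INR s <= INR a * INR t ->
  INR ('C(u, t) * 'C(a - t, s - t)) <= exp (- 2 * INR t) * INR 'C(a, s).
Proof.
move=> t0 ts sa H.
have tR : 0 < INR t by apply: (lt_INR 0); apply/ltP.
have aR : 0 < INR a by apply: (lt_INR 0); apply/ltP; lia.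
have /INR_leq := bin_sub_ratio ts sa; rewrite !INR_muln !INR_expn => h1.
have h2 := bin_le_pow u t.
have at0 : 0 < INR a * INR t by nra.
have h3 : INR 'C(u, t) * INR 'C(a - t, s - t) * (INR a * INR t) ^ t <=
    (3 * INR u * INR s) ^ t * INR 'C(a, s).
  rewrite [(INR a * _) ^ t]Rpow_mult_distr [X in _ <= X * _]Rpow_mult_distr.
  have p1 : 0 <= INR 'C(u, t) * INR t ^ t.
    by apply: Rmult_le_pos; [apply: pos_INR | apply: pow_le; lra].
  have p2 : 0 <= INR 'C(a - t, s - t) * INR a ^ t.
    by apply: Rmult_le_pos; [apply: pos_INR | apply: pow_le; lra].
  have := Rmult_le_compat _ _ _ _ p1 p2 h2 h1; lra.
have h4 : 3 * INR u * INR s <= / 9 * (INR a * INR t) by lra.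
have p0 : 0 <= 3 * INR u * INR s by have := pos_INR u; have := pos_INR s; nra.
have := ratio_pow at0 p0 (pos_INR _) h4 h3.
have h5 : (/ 9) ^ t <= exp (- 2 * INR t).
  rewrite exp_mul_INR; apply: pow_incr; split; first lra.
  have -> : -2 = - (1 + 1) by ring.
  rewrite exp_Ropp exp_plus; apply: Rinv_le_contravar; first by have := exp_pos 1; nra.
  by have := exp_pos 1; have := exp_le_3; nra.
by have := pos_INR 'C(a, s); nra.
Qed.

(** * Admissible sets and the parameter eps *)

Lemma card_add_ord_le n (J : {set 'I_n.+1}) :
  (#|@add_ord n @2: (J, J)| <= sumset_card J)%N.
Proof.
rewrite cardE -(size_map (@nat_of_ord _)) /sumset_card; apply: uniq_leq_size.
  by rewrite map_inj_uniq ?enum_uniq //; exact: val_inj.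
move=> c /mapP [z + ->]; rewrite mem_enum => /imset2P [x y xJ yJ ->].
by rewrite mem_undup add_ordE; apply: allpairs_f; rewrite mem_enum.
Qed.

Lemma admissibleP n s K (J : {set 'I_n.+1}) : admissible s K J ->
  [/\ J \subset [set i : 'I_n.+1 | (0 < i)%N], #|J| = s &
      INR (sumset_card J) <= K * INR s].
Proof.
case/and3P => rJ /eqP Js; rewrite Js /Rleb.
by case: Rle_dec.
Qed.

(** Sums of two elements of 1..l lie in [2, 2l], which has 2l - 1 <= m elements. *)
Lemma card_admissible_ge n s m K l : (l <= n)%N -> (0 < l)%N -> (l + l <= m.+1)%N ->
  INR m <= K * INR s ->
  ('C(l, s) <= #|[set J : {set 'I_n.+1} | admissible s K J]|)%N.
Proof.
move=> ln l0 lm mK.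
pose P := [set i : 'I_n.+1 | (0 < i <= l)%N].
have cP : #|P| = l.
  have fI : injective (fun i : 'I_l => inord i.+1 : 'I_n.+1).
    move=> i j /(congr1 (@nat_of_ord _)).
    have h (k : 'I_l) : (k.+1 < n.+1)%N by rewrite ltnS; apply: leq_trans (ltn_ord k) ln.
    by rewrite !inordK // => -[] /val_inj.
  rewrite -[RHS](card_ord l) -cardsT -(card_imset _ fI); apply: eq_card => x; rewrite !inE.
  have [xP|xP] := boolP (0 < x <= l)%N; apply/esym.
    have lx : (x.-1 < l)%N by lia.
    apply/imsetP; exists (Ordinal lx) => //; apply: val_inj; rewrite /= inordK; lia.
  apply/imsetP => -[i _ xE]; move: xP; rewrite xE inordK; have := ltn_ord i; lia.
rewrite -{1}cP -cards_draws; apply: subset_leq_card; apply/subsetP => J.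
rewrite !inE => /andP [JP /eqP Js]; apply/and3P; split; [|by apply/eqP|].
  by apply: subset_trans JP _; apply/subsetP => x; rewrite !inE => /andP [].
rewrite /Rleb; case: Rle_dec => //; case; rewrite Js; apply: Rle_trans mK; apply: INR_leq.
apply: (@leq_trans (size (iota 2 (l + l).-1))); last by rewrite size_iota; lia.
apply: uniq_leq_size; first exact: undup_uniq.
move=> c; rewrite mem_undup => /allpairsP [[x y] /= [+ + ->]].
rewrite !mem_enum mem_iota => /(subsetP JP) + /(subsetP JP); rewrite !inE; lia.
Qed.

(** The fractional powers are eliminated here: later estimates use only [e ^ 6 * s = K * L ^ 3]. *)
Lemma eps_facts s L K : 0 < s -> 0 < L -> 0 < K ->
  exists e, [/\ 0 < e, e ^ 6 * s = K * L ^ 3,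
    Rpower K (1 / 6) * Rpower s (5 / 6) * sqrt L = e * s &
    Rpower K (7 / 6) * Rpower s (5 / 6) * sqrt L = e * (K * s)].
Proof.
move=> s0 L0 K0.
have p6 x : Rpower x (1 / 6) ^ 6 = Rpower x 1.
  rewrite -Rpower_pow; last exact: exp_pos.
  by rewrite Rpower_mult; congr (Rpower _ _); rewrite /=; field.
have h5 : Rpower s (5 / 6) * Rpower s (1 / 6) = s.
  by rewrite -Rpower_plus -[RHS](Rpower_1 s) //; congr (Rpower _ _); field.
have h7 : Rpower K (7 / 6) = K * Rpower K (1 / 6).
  by rewrite -{2}(Rpower_1 K) // -Rpower_plus; congr (Rpower _ _); field.
have r0 : 0 < Rpower s (1 / 6) by exact: exp_pos.
have k0 : 0 < Rpower K (1 / 6) by exact: exp_pos.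
have sq0 := sqrt_lt_R0 _ L0.
exists (Rpower K (1 / 6) * / Rpower s (1 / 6) * sqrt L).
have E : Rpower K (1 / 6) * Rpower s (5 / 6) * sqrt L =
    Rpower K (1 / 6) * / Rpower s (1 / 6) * sqrt L * s.
  by rewrite -{3}h5; field; lra.
split.
- by apply: Rmult_lt_0_compat => //; apply: Rmult_lt_0_compat => //; apply: Rinv_0_lt_compat.
- have sqE : sqrt L ^ 6 = L ^ 3.
    have -> : sqrt L ^ 6 = (sqrt L * sqrt L) ^ 3 by ring.
    by rewrite sqrt_sqrt //; lra.
  rewrite !Rpow_mult_distr sqE p6 Rpower_1 // pow_inv p6 Rpower_1 //.
  by field; lra.
- exact: E.
- by rewrite h7 Rmult_assoc Rmult_assoc -[Rpower K _ * _]Rmult_assoc E; ring.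
Qed.

(** * Choice of parameters *)

(** [Q] is about [1 / (256 * e)], [D = Q ^ 2], [p] is the integer part of [y], and [g] is about
    [p / (4 * D)]. This [y] balances the two costs, [p * r] selections and [m / g] enlargements of
    [B]. *)
Lemma containers_exist n s K e m l :
    (1 < n)%N -> 2 <= K -> 0 < e -> e <= / 1048576 -> e ^ 6 * INR s = K * ln (INR n) ^ 3 ->
    INR m <= K * INR s -> K * INR s < INR m + 1 ->
    (m <= n + n)%N -> (m <= l + l)%N -> 1048576 <= INR s ->
  exists Q M0 (C : seq {set 'I_n.+1}),
    [/\ 1 <= 512 * e * INR Q, INR M0 <= (1 - 4 * e) * INR l < INR M0 + 1,
        INR (size C) <= exp (e * INR s),
        {in C, forall X : {set 'I_n.+1}, good_container (@add_ord n) m (Q ^ 2) M0 X} &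
        forall J : {set 'I_n.+1}, J \subset [set i : 'I_n.+1 | (0 < i)%N] ->
          (#|@add_ord n @2: (J, J)| <= m)%N -> exists2 X, X \in C & J \subset X].
Proof.
set L := ln (INR n); set S := INR s.
move=> n1 K2 e0 e1 e6 mK Km mn ml Sbig.
have nR : 2 <= INR n by rewrite -[2]/(INR 2); apply: INR_leq.
have L2 : / 2 < L.
  apply: Rlt_le_trans ln_lt_2 _; rewrite /L.
  case: (Rle_lt_or_eq_dec _ _ nR) => [n2|<-]; last exact: Rle_refl.
  by apply/Rlt_le/ln_increasing; lra.
(* [y] is [sqrt (K * S / L)], the number of elements collected in a round. *)
pose y := e ^ 3 * S / L ^ 2.
have L20 : 0 < L ^ 2 by apply: pow_lt; lra.
have yL : y * L ^ 2 = e ^ 3 * S by rewrite /y; field; lra.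
have e3 : 0 < e ^ 3 by apply: pow_lt.
have ye3 : y * e ^ 3 = K * L.
  apply: (Rmult_eq_reg_r (L ^ 2)); last lra.
  have -> : K * L * L ^ 2 = K * L ^ 3 by ring.
  by rewrite -e6 -/S Rmult_assoc [e ^ 3 * L ^ 2]Rmult_comm -Rmult_assoc yL; ring.
have yy : y ^ 2 * L = K * S.
  apply: (Rmult_eq_reg_r (e ^ 3 * L)); last nra.
  have -> : y ^ 2 * L * (e ^ 3 * L) = (y * e ^ 3) * (y * L ^ 2) by ring.
  by rewrite ye3 yL; ring.
have KL1 : 1 < K * L by nra.
have y0 : 0 < y by nra.
have e2 : 0 < e ^ 2 by apply: pow_lt.
have ye2 : 1048576 <= y * e ^ 2.
  have : 1 <= y * e ^ 2 * e by (have -> : y * e ^ 2 * e = y * e ^ 3 by ring); lra.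
  have : 0 < y * e ^ 2 by nra.
  by nra.
have e2s : e ^ 2 <= / 1048576 by nra.
have ybig : 1048576 <= y by nra.
have yS : y <= S / 1048576.
  have e3s : e ^ 3 <= / 1048576 * / 4 by rewrite -[e ^ 3]/(e * e ^ 2); nra.
  have L24 : / 4 <= L ^ 2 by nra.
  have S0 : 0 < S by lra.
  by nra.
have [Q [Q1 Q2]] : exists Q : nat, INR Q <= / (256 * e) < INR Q + 1.
  by apply: floorP; apply/Rlt_le/Rinv_0_lt_compat; lra.
have ie : / (256 * e) * (256 * e) = 1 by apply: Rinv_l; lra.
have Qe : INR Q * (256 * e) <= 1 by nra.
have Qbig : 4 <= INR Q + 1.
  have : 1 < (INR Q + 1) * (256 * e) by nra.
  have := pos_INR Q; nra.
have Qe2 : 1 <= 512 * e * INR Q by nra.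
have [p [p1 p2]] := floorP (Rlt_le _ _ y0).
have l_ge : K * S - 1 < 2 * INR l by have := INR_leq ml; rewrite INR_addn; lra.
have KS2 : 2 * S <= K * S by nra.
have l_big : S - 1 < INR l by lra.
have [M0 [M01 M02]] : exists M0 : nat, INR M0 <= (1 - 4 * e) * INR l < INR M0 + 1.
  by apply: floorP; have := pos_INR l; clear -e1; nra.
have M0l : 3 / 4 * INR l - 1 < INR M0.
  have := Rmult_le_compat_r _ _ _ (pos_INR l) e1; clear -M02 l_big Sbig; lra.
pose D := (Q ^ 2)%N.
have DR : INR D = INR Q ^ 2 by rewrite INR_expn.
have D1 : 1 <= INR D by rewrite DR; nra.
have D0 : (0 < D)%N by apply: (@ltn_of_INR 0); rewrite /=; lra.
have De : INR D * (65536 * e ^ 2) <= 1.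
  rewrite DR; have -> : INR Q ^ 2 * (65536 * e ^ 2) = (INR Q * (256 * e)) ^ 2 by ring.
  have : 0 <= INR Q * (256 * e) by have := pos_INR Q; clear -e0; nra.
  by move: (INR Q * _) Qe => x; clear; nra.
pose g := (p %/ (4 * D))%N.
have D4p : 4 * INR D <= INR p.
  have : INR D * 65536 <= y * / 1048576.
    by apply: (Rmult_le_reg_r (e ^ 2)) => //; clear -De ye2; lra.
  by clear -p2 ybig; lra.
have I4 : INR 4 = 4 by rewrite /=; ring.
have D40 : (0 < 4 * D)%N by rewrite muln_gt0.
have g0 : (0 < g)%N.
  by rewrite divn_gt0 //; apply: leq_of_INR; rewrite INR_muln I4.
have gp : (4 * D * g <= p)%N by rewrite mulnC; exact: leq_divM.
have pg : (p <= 8 * D * g)%N.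
  have : (p < g.+1 * (4 * D))%N by rewrite -ltn_divLR.
  by rewrite mulSn; nia.
have gM : (2 * D * g <= M0)%N.
  apply: leq_of_INR; have := INR_leq gp; rewrite !INR_muln I4.
  have -> : INR 2 = 2 by [].
  by clear -M0l p1 yS l_big Sbig; lra.
have mM : (m <= 4 * M0)%N.
  apply: leq_of_INR; have := INR_leq ml; rewrite INR_muln INR_addn I4.
  by clear -M0l l_big Sbig; lra.
(* As [z > 6 * L] and [ln 2 > 1 / 2], [2 ^ z] is at least [n ^ 3 >= 3 * n], which bounds the initial
   slack [n + m]. *)
have [k [k1 k2]] : exists k : nat, INR k <= 6 * L < INR k + 1 by apply: floorP; lra.
pose z := k.+1; pose r := (20 * D * z)%N.
have zR : INR z = INR k + 1 by rewrite S_INR.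
have z2 : 3 * INR n <= 2 ^ z.
  have nexp : exp L = INR n by rewrite exp_ln; lra.
  have <- : exp (ln 2) = 2 by rewrite exp_ln; lra.
  rewrite -exp_mul_INR.
  apply: (@Rle_trans _ (exp (L + L + L))).
    rewrite !exp_plus nexp; have : 4 <= INR n * INR n by clear -nR; nra.
    by clear -nR; nra.
  have h : L + L + L <= ln 2 * INR z by have := ln_lt_2; rewrite zR; clear -k2 L2; nra.
  by case: (Rle_lt_or_eq_dec _ _ h) => [/exp_increasing|->]; lra.
have Ur : ((n + m) * (20 * D) ^ r <= (20 * D).+1 ^ r)%N.
  have D20 : (0 < 20 * D)%N by rewrite muln_gt0.
  have := double_pow_succ D20; rewrite -(leq_exp2r _ _ (isT : 0 < z)%N).
  rewrite expnMn -!expnM -/r; apply: leq_trans; rewrite leq_mul2r; apply/orP; right.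
  apply: leq_of_INR; rewrite INR_expn; apply: Rle_trans z2.
  by have := INR_leq mn; rewrite !INR_addn; lra.
pose q := (p * r.+1 + (m %/ g).+1)%N.
have qge : (g * (p * r.+1) + m.+1 <= g * q)%N.
  rewrite /q mulnDr leq_add2l mulnC; exact: ltn_ceil.
pose A0 := [set i : 'I_n.+1 | (0 < i)%N].
have cA0 : #|A0| = n.
  have := cardsC A0; rewrite card_ord (_ : ~: A0 = [set ord0]) ?cards1; first by lia.
  by apply/setP => i; rewrite !inE -leqNgt leqn0.
rewrite -{1}cA0 in Ur.
have [C [sC gC HC]] := container_family (@add_ordC n) (@add_ordI n) D0 g0 gp gM mM Ur qge.
exists Q, M0, C; split => //.
have n_exp : INR n.+1 <= exp (2 * L).
  rewrite (_ : 2 * L = L + L); last by ring.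
  rewrite exp_plus exp_ln; last by lra.
  by rewrite S_INR; clear -nR; nra.
apply: Rle_trans (INR_leq sC) _; rewrite cA0 INR_expn.
apply: (@Rle_trans _ (exp (2 * L) ^ q)); first by apply: pow_incr; split; [apply: pos_INR|].
rewrite -exp_mul_INR.
have yD : 1 <= y * INR D by clear -ybig D1; nra.
(* [z <= 8 * L] gives 160 for the selections, [g >= y / (16 * D)] and [y ^ 2 * L = K * S] give 16
   for the enlargements, and the rounding terms give 4. *)
have qR : INR q <= 180 * (INR D * y * L).
  have h1 : INR (p * r.+1) <= y * (160 * INR D * L + 1).
    rewrite INR_muln S_INR; apply: Rmult_le_compat => //.
    - exact: pos_INR.
    - by have := pos_INR r; lra.
    - rewrite /r !INR_muln zR (_ : INR 20 = 20); last by rewrite /=; ring.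
      by clear -k1 D1 L2; nra.
  have h2 : INR (m %/ g) <= 16 * (INR D * y * L).
    have a1 : INR (m %/ g) * INR g <= INR m by rewrite -INR_muln; apply/INR_leq/leq_divM.
    have a2 : INR p <= 8 * (INR D * INR g).
      by have := INR_leq pg; rewrite !INR_muln (_ : INR 8 = 8); [lra | rewrite /=; ring].
    have a3 : INR (m %/ g) * (y / 2) <= INR (m %/ g) * (8 * (INR D * INR g)).
      by apply: Rmult_le_compat_l; [exact: pos_INR | clear -a2 p2 ybig; lra].
    have a4 : INR (m %/ g) * INR g * (8 * INR D) <= y ^ 2 * L * (8 * INR D).
      by apply: Rmult_le_compat_r; [clear -D1; lra | rewrite yy; lra].
    apply: (Rmult_le_reg_r (y / 2)); first by lra.
    by clear -a3 a4; lra.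
  rewrite /q INR_addn S_INR.
  have : y <= 2 * (INR D * y * L).
    have : 1 <= INR D * L * 2 by clear -D1 L2; nra.
    by clear -y0; nra.
  have : 1 <= y by lra.
  by clear -h1 h2; lra.
have h : 2 * L * INR q <= e * S.
  have h1 : 2 * L * INR q <= 2 * L * (180 * (INR D * y * L)).
    by apply: Rmult_le_compat_l => //; lra.
  have h2 : 2 * L * (180 * (INR D * y * L)) = 360 * (INR D * e ^ 2) * (e * S).
    have -> : 360 * (INR D * e ^ 2) * (e * S) = 360 * INR D * (e ^ 3 * S) by ring.
    by rewrite -yL; ring.
  have eS : 0 < e * S by clear -e0 Sbig; nra.
  have h3 : INR D * e ^ 2 <= / 65536 by lra.
  by clear -h1 h2 h3 eS; nra.
by case: (Rle_lt_or_eq_dec _ _ h) => [/exp_increasing|->]; lra.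
Qed.

(** * Exceptional sets of a single container *)

Lemma in_short_AP_real n (S : {set 'I_n.+1}) (k : nat) (L : R) :
  INR k <= L -> in_short_AP S k -> in_AP_of_size_le S L.
Proof.
move=> kL [a [d AP]]; exists (Z.of_nat a), (Z.of_nat d), k; split=> // x xS.
by have [j jk xE] := AP x xS; exists j; split=> //; rewrite /= xE; lia.
Qed.

Lemma INR_subn_le a b x : 0 <= x -> INR a - INR b <= x -> INR (a - b) <= x.
Proof.
move=> x0 h; have [ab|/ltnW ba] := leqP a b; first by rewrite (eqP ab).
by rewrite minus_INR //; apply/leP.
Qed.

Lemma exp_le x y : x <= y -> exp x <= exp y.
Proof. by case/Rle_lt_or_eq_dec => [/exp_increasing/Rlt_le //|->]; apply: Rle_refl. Qed.

Lemma container_exceptions n s K e m l Q M0 (X : {set 'I_n.+1}) :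
    2 <= K -> 0 < e -> e <= / 1048576 -> 1048576 <= e * INR s ->
    INR m <= K * INR s -> K * INR s < INR m + 1 ->
    (m <= l + l)%N -> (l + l <= m.+1)%N ->
    1 <= 512 * e * INR Q -> INR M0 <= (1 - 4 * e) * INR l < INR M0 + 1 ->
    good_container (@add_ord n) m (Q ^ 2) M0 X ->
  exists F : {set {set 'I_n.+1}},
    INR #|F| <= exp (- (2 * (e * INR s))) * INR 'C(l, s) /\
    forall J : {set 'I_n.+1}, #|J| = s -> J \subset X -> J \in F \/
      exists T : {set 'I_n.+1}, [/\ T \subset J, INR #|T| <= 2 ^ 15 * (e * INR s) &
        in_AP_of_size_le (J :\: T) (K * INR s / 2 + 2 ^ 17 * (e * (K * INR s)))].
Proof.
set S := INR s => K2 e0 e1 eS mK Km ml lm Qe [M01 M02] gX.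
have Sbig : 1048576 * 1048576 <= S by nra.
have KS2 : 2 * S <= K * S by nra.
have mlR := INR_leq ml; rewrite INR_addn in mlR.
have lmR := INR_leq lm; rewrite INR_addn S_INR in lmR.
have l_big : S - 1 < INR l by lra.
have l0 : (0 < l)%N by apply: (@ltn_of_INR 0); rewrite /=; lra.
have Cl0 := pos_INR 'C(l, s).
have [XM|XM] := leqP #|X| M0.
  exists [set J : {set 'I_n.+1} | J \subset X & #|J| == s]; split.
    rewrite cards_draws; apply: Rle_trans (INR_leq (leq_bin2l _ XM)) _.
    apply: Rle_trans (@bin_shrink l M0 (4 * e) s _ _ l0 M01) _; [lra | lra |].
    apply: Rmult_le_compat_r => //; apply: exp_le.
    by rewrite -/S; clear -eS; lra.
  by move=> J Js JX; left; rewrite inE JX Js eqxx.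
have [B [Bm [|miss]]] := gX; first by rewrite leqNgt XM.
have Q0 : (0 < Q)%N by case: (Q) Qe => //=; lra.
set u := (#|X| %/ Q)%N; set a := INR #|X|.
have aM : INR M0 + 1 <= a by rewrite -S_INR; apply: INR_leq.
have a0 : 0 <= a by apply: pos_INR.
have ea := Rmult_le_compat_r _ _ _ a0 e1.
have el := Rmult_le_compat_r _ _ _ (pos_INR l) e1.
have ua : INR u <= 512 * (e * a).
  have h1 : INR u * INR Q <= a by rewrite -INR_muln; apply/INR_leq/leq_divM.
  have h2 : INR u * 1 <= INR u * (512 * e * INR Q).
    by apply: Rmult_le_compat_l => //; apply: pos_INR.
  have h3 : 512 * e * (INR u * INR Q) <= 512 * e * a by apply: Rmult_le_compat_l => //; lra.
  by lra.
have al : (1 - / 262144) * INR l <= a by clear -aM M02 el; lra.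
have large : (2 * m + 13 * u + 5 < 5 * #|X|)%N.
  apply: ltn_of_INR; rewrite 2!INR_addn 3!INR_muln -/a.
  have -> : INR 2 = 2 by [].
  have -> : INR 5 = 5 by rewrite /=; ring.
  have -> : INR 13 = 13 by rewrite /=; ring.
  by clear -al ua ea mlR l_big Sbig; lra.
have [t0 [t1 t2]] : exists t0 : nat, INR t0 <= 32768 * (e * S) < INR t0 + 1.
  by apply: floorP; lra.
have [a_le [F [cF HF]]] := large_container s t0.+1 Q0 Bm miss large.
rewrite -/u in a_le cF HF.
have a_leR : 2 * a <= 2 * INR l + 5 * INR u + 2.
  have := INR_leq a_le; rewrite INR_muln 2!INR_addn INR_muln -/a.
  have -> : INR 2 = 2 by [].
  have -> : INR 5 = 5 by rewrite /=; ring.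
  by lra.
have a_l : a <= 11 / 10 * INR l by clear -a_leR ua ea l_big Sbig; lra.
exists F; split; last first.
  move=> J Js JX; case: (HF J Js JX) => [|[T [TJ Tt AP]]]; [by left | right].
  exists T; split=> //.
    have := INR_leq (Tt : (#|T| <= t0)%N); move=> h.
    have -> : 2 ^ 15 = 32768 by ring.
    by lra.
  apply: in_short_AP_real AP.
  have -> : 2 ^ 17 = 131072 by ring.
  have eK : e * (K * S) >= 2 * (e * S) by clear -e0 KS2; nra.
  have em := Rmult_le_compat_l _ _ _ (Rlt_le _ _ e0) mK.
  have eml := Rmult_le_compat_l _ _ _ (Rlt_le _ _ e0) lmR.
  have eal := Rmult_le_compat_l _ _ _ (Rlt_le _ _ e0) a_l.
  (* As [a] is at least [(1 - 4 * e) * l] and [l] is about [m / 2], the main term of the length is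
     [2 * m - 3 * m / 2 = m / 2]. *)
  apply: INR_subn_le; first by clear -eK eS KS2 Sbig; lra.
  rewrite 2!INR_addn 3!INR_muln -/a.
  have -> : INR 2 = 2 by [].
  have -> : INR 3 = 3 by rewrite /=; ring.
  have -> : INR 4 = 4 by rewrite /=; ring.
  have -> : INR 11 = 11 by rewrite /=; ring.
  by clear -aM M02 ua mlR lmR em eml eal mK eK eS e1; lra.
apply: Rle_trans (INR_leq cF) _.
(* If [u] is below the threshold, no set is heavy and the first binomial vanishes. *)
have [ut|tu] := ltnP u t0.+1.
  rewrite bin_small // mul0n /=.
  by apply: Rmult_le_pos => //; apply/Rlt_le/exp_pos.
have tuR : 32768 * (e * S) <= INR u.
  by have := INR_leq tu; rewrite S_INR; lra.
(* From [32768 * e * S <= u <= 512 * e * a]: the container is much larger than [s], hence so is [l],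
   as [bin_grow] requires. *)
have aS : 64 * S <= a by apply: (Rmult_le_reg_l e) => //; lra.
have eSS : e * S <= / 1048576 * S by apply: Rmult_le_compat_r => //; lra.
have sX : (s <= #|X|)%N by apply: leq_of_INR; rewrite -/S -/a; clear -aS Sbig; lra.
have ts : (t0.+1 <= s)%N.
  by apply: leq_of_INR; rewrite S_INR -/S; clear -t1 eSS Sbig; lra.
have tR : 32768 * (e * S) <= INR t0.+1 by rewrite S_INR; lra.
have hb : 27 * INR u * INR s <= INR #|X| * INR t0.+1.
  rewrite -/S -/a.
  have h1 := Rmult_le_compat_l _ _ _ a0 tR.
  have h2 : INR u * S <= 512 * (e * a) * S by apply: Rmult_le_compat_r => //; lra.
  have h3 : 0 <= a * (e * S) by apply: Rmult_le_pos => //; lra.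
  by clear -h1 h2 h3; lra.
apply: Rle_trans (heavy_bin (ltn0Sn _) ts sX hb) _.
have sl : (s < l)%N.
  by apply: ltn_of_INR; rewrite -/S; clear -aS a_l Sbig; lra.
have Xl : (#|X| <= l + (3 * u).+1)%N by lia.
have xc : INR (3 * u).+1 <= 8192 * e * (INR l - INR s).
  rewrite S_INR INR_muln -/S.
  have -> : INR 3 = 3 by rewrite /=; ring.
  have h1 := Rmult_le_compat_l _ _ _ (Rlt_le _ _ e0) a_l.
  have h2 := Rmult_le_compat_l _ _ _ (Rlt_le _ _ e0) aS.
  by clear -ua h1 h2 eS; lra.
have e8 : 0 <= 8192 * e by lra.
(* Passing from [#|X|] to [l] costs [exp (2 ^ 13 * e * s)], far less than the saving
   [exp (- 2 ^ 16 * e * s)]. *)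
apply: Rle_trans (_ : _ <= exp (- 2 * INR t0.+1) * (exp (8192 * e * INR s) * INR 'C(l, s))) _.
  by apply: Rmult_le_compat_l; [apply/Rlt_le/exp_pos | apply: bin_grow e8 sl Xl xc].
rewrite -Rmult_assoc -exp_plus -/S; apply: Rmult_le_compat_r => //; apply: exp_le.
by clear -tR eS; lra.
Qed.

(** * Union over the containers *)

Theorem theorem5p1 (s n : nat) (K : R) :
  (0 < s)%N -> (0 < n)%N ->
  Rle 2 K ->
  Rle (K * (2 ^ 120 * (ln (INR n)) ^ 3)) (INR s) ->
  exists G : {set {set 'I_n.+1}},
    G \subset [set J : {set 'I_n.+1} | admissible s K J] /\
    (forall J, J \in G ->
       exists T : {set 'I_n.+1}, T \subset J /\
         Rle (INR #|T|) (2 ^ 15 * Rpower K (1/6) * Rpower (INR s) (5/6)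
                        * sqrt (ln (INR n))) /\
         in_AP_of_size_le (J :\: T)
           (K * INR s / 2 + 2 ^ 17 * Rpower K (7/6) * Rpower (INR s) (5/6)
                        * sqrt (ln (INR n)))) /\
    Rle ((1 - exp (- (Rpower K (1/6) * Rpower (INR s) (5/6) * sqrt (ln (INR n)))))
           * INR #|[set J : {set 'I_n.+1} | admissible s K J]|)
        (INR #|G|).
Proof.
move=> s0 n0 K2 Ks.
set Adm := [set J | admissible s K J].
have S1 : 1 <= INR s by rewrite -[1]/(INR 1); apply: INR_leq.
have [m [m1 m2]] : exists m : nat, INR m <= K * INR s < INR m + 1 by apply: floorP; nra.
have AP_all (J : {set 'I_n.+1}) : J \in Adm -> in_short_AP J n.
  rewrite inE => /admissibleP [rJ _ _]; exists 1%N, 1%N => x /(subsetP rJ).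
  by rewrite inE => x0; exists x.-1; have := ltn_ord x; lia.
(* If [m >= 2 * n], then [K * s / 2 >= n] and 1..n is already short enough, with [T] empty. This
   disposes of [n = 1], where the logarithm vanishes. *)
have [nm|mn] := leqP (n + n) m.
  have R1 := exp_pos (1 / 6 * ln K); have R2 := exp_pos (5 / 6 * ln (INR s)).
  have R3 := exp_pos (7 / 6 * ln K); have R4 := sqrt_pos (ln (INR n)).
  exists Adm; split=> //; split.
    move=> J JA; exists set0; rewrite sub0set cards0 setD0; split=> //.
    have P1 a c : 0 < a -> 0 <= 2 ^ c * a * Rpower (INR s) (5 / 6) * sqrt (ln (INR n)).
      move=> a0; apply: Rmult_le_pos R4; apply: Rmult_le_pos (Rlt_le _ _ R2).
      by apply: Rmult_le_pos (Rlt_le _ _ a0); apply: pow_le; lra.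
    split; first exact: P1.
    apply: in_short_AP_real (AP_all J JA).
    have := P1 _ 17%N R3; have := INR_leq nm; rewrite INR_addn -/(Rpower K (7 / 6)).
    by lra.
  have := exp_pos (- (Rpower K (1 / 6) * Rpower (INR s) (5 / 6) * sqrt (ln (INR n)))).
  move=> W0; rewrite -[X in _ <= X]Rmult_1_l.
  by apply: Rmult_le_compat_r; [exact: pos_INR | lra].
have m_ge2 : (1 < m)%N by apply: (@ltn_of_INR 1); rewrite /=; nra.
have n1 : (1 < n)%N by lia.
have nR : 2 <= INR n by rewrite -[2]/(INR 2); apply: INR_leq.
have L2 : / 2 < ln (INR n).
  apply: Rlt_le_trans ln_lt_2 _.
  case: (Rle_lt_or_eq_dec _ _ nR) => [n2|<-]; last exact: Rle_refl.
  by apply/Rlt_le/ln_increasing; lra.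
have [e [e0 e6 eW eW']] := @eps_facts (INR s) (ln (INR n)) K ltac:(lra) ltac:(lra) ltac:(lra).
rewrite eW.
have W15 : 2 ^ 15 * Rpower K (1/6) * Rpower (INR s) (5/6) * sqrt (ln (INR n)) =
    2 ^ 15 * (e * INR s) by rewrite -eW; ring.
have W17 : 2 ^ 17 * Rpower K (7/6) * Rpower (INR s) (5/6) * sqrt (ln (INR n)) =
    2 ^ 17 * (e * (K * INR s)) by rewrite -eW'; ring.
rewrite W15 W17 {W15 W17 eW eW'}.
(* The constant is 2^20, and 2^120 in the hypothesis is its sixth power. *)
have e1 : e <= / 1048576.
  apply: Rnot_lt_le => e_gt.
  have : 1 < (e * 1048576) ^ 6 by apply: Rlt_pow_R1; [lra | lia].
  have -> : (e * 1048576) ^ 6 = 2 ^ 120 * e ^ 6 by ring.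
  have : 2 ^ 120 * e ^ 6 * INR s <= INR s by rewrite Rmult_assoc e6; lra.
  by move: (2 ^ 120 * e ^ 6) => x; clear -S1; nra.
(* [e ^ 5 * (e * s) = K * L ^ 3 >= 1 / 4], while [e ^ 5 <= 2 ^ -100]. *)
have eS : 1048576 <= e * INR s.
  have KL : / 4 <= K * ln (INR n) ^ 3.
    have : / 8 <= ln (INR n) ^ 3.
      by have := @pow_incr (/ 2) (ln (INR n)) 3 ltac:(lra); lra.
    by clear -K2; nra.
  have e5 : e ^ 5 <= (/ 1048576) ^ 5 by apply: pow_incr; lra.
  have es0 : 0 < e * INR s by clear -e0 S1; nra.
  have : / 4 <= e ^ 5 * (e * INR s).
    by apply: Rle_trans KL _; rewrite -e6; apply: Req_le; ring.
  have := Rmult_le_compat_r _ _ _ (Rlt_le _ _ es0) e5; lra.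
have Sbig : 1048576 <= INR s by clear -eS e1 S1; nra.
(* The largest [l] with [2 * l - 1 <= m], so that all [s]-subsets of 1..l are admissible. *)
pose l := (m.+1)./2.
have ml : (m <= l + l)%N by rewrite /l; lia.
have lm : (l + l <= m.+1)%N by rewrite /l; lia.
have ln_ : (l <= n)%N by lia.
have l0 : (0 < l)%N by lia.
have [Q [M0 [C [Qe M0E sC gC HC]]]] :=
  containers_exist n1 K2 e0 e1 e6 m1 m2 (ltnW mn) ml Sbig.
have Cl0 := pos_INR 'C(l, s).
have exp2 := exp_pos (- (2 * (e * INR s))).
have [b [b1 b2]] : exists b : nat,
    INR b <= exp (- (2 * (e * INR s))) * INR 'C(l, s) < INR b + 1.
  by apply: floorP; apply: Rmult_le_pos => //; lra.
pose Good (J : {set 'I_n.+1}) := exists T : {set 'I_n.+1},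
  [/\ T \subset J, INR #|T| <= 2 ^ 15 * (e * INR s) &
      in_AP_of_size_le (J :\: T) (K * INR s / 2 + 2 ^ 17 * (e * (K * INR s)))].
have [X XC|F [cF HF]] := @cover_union _ Good (fun J => admissible s K J) b C.
  have [F [cF HF]] := container_exceptions K2 e0 e1 eS m1 m2 ml lm Qe M0E (gC X XC).
  exists F; split; last by move=> J /admissibleP [_ Js _]; apply: HF.
  rewrite -ltnS; apply: ltn_of_INR; rewrite S_INR; lra.
exists (Adm :\: F); split; first exact: subsetDl.
split.
  move=> J; rewrite !inE => /andP [JF aJ].
  have [rJ Js sumJ] := admissibleP aJ.
  have Jm : (#|@add_ord n @2: (J, J)| <= m)%N.
    apply: leq_trans (card_add_ord_le J) _; rewrite -ltnS; apply: ltn_of_INR.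
    by rewrite S_INR; lra.
  have [X XC JX] := HC J rJ Jm.
  have [JF'|[T [TJ Tt AP]]] := HF J X aJ XC JX; first by rewrite JF' in JF.
  by exists T.
have cA : INR 'C(l, s) <= INR #|Adm| by apply: INR_leq; apply: card_admissible_ge ln_ l0 lm m1.
(* The number of containers, at most [exp (e * s)], uses up half of the saving
   [exp (- 2 * e * s)]. *)
have cF' : INR #|F| <= exp (- (e * INR s)) * INR 'C(l, s).
  apply: Rle_trans (INR_leq cF) _; rewrite INR_muln.
  apply: Rle_trans (_ : _ <= exp (e * INR s) * (exp (- (2 * (e * INR s))) * INR 'C(l, s))) _.
    by apply: Rmult_le_compat => //; apply: pos_INR.
  rewrite -Rmult_assoc -exp_plus; apply: Rmult_le_compat_r => //; apply: exp_le; lra.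
have cG : INR #|Adm| <= INR #|Adm :\: F| + INR #|F|.
  rewrite -INR_addn; apply: INR_leq; rewrite -(cardsID F Adm) addnC leq_add2l.
  by apply: subset_leq_card; apply: subsetIr.
have wA := Rmult_le_compat_l _ _ _ (Rlt_le _ _ (exp_pos (- (e * INR s)))) cA.
have final w x y f c : x <= y + f -> f <= w * c -> w * c <= w * x -> (1 - w) * x <= y by lra.
exact: final cG cF' wA.
Qed.
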